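(* The inversion map $\mathrm{Inv}:\mathcal{D}(\mathbb{R})\to\mathcal{D}(\mathbb{R})$, $\eta\mapsto\eta^{-1}$, is continuous.
   Context: $\mathcal{D}(\mathbb{R})$ is the set of maps $\eta:\mathbb{R}\to\mathbb{R}$ such that: (1) $\eta$ is $C^1$ with $a\le\eta'(x)\le b$ on $\mathbb{R}$ for some $0<a<b$ (depending on $\eta$); (2) $\int_{\mathbb{R}}|\eta(x)-x|^2dx<\infty$ and $\int_{\mathbb{R}}|\eta'(x)-1|^2dx<\infty$; (3) $\lim_{|x|\to\infty}\eta'(x)=1$. It is a group under composition. Its topology is given by the distance $D(\eta,\xi)=\|\eta-\xi\|_{1,1}$, where $\|u\|_{1,1}=\sup_{x}|u(x)|+\sup_{x}|u'(x)|+\left(\int_{\mathbb{R}}u(x)^2dx+\int_{\mathbb{R}}u'(x)^2dx\right)^{1/2}$. *)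

(* Defs.v *)
From HB Require Import structures.
From mathcomp Require Import all_boot all_order all_algebra.
From mathcomp Require Import ring lra.
From mathcomp Require Import all_classical all_reals all_analysis measurable_realfun.

Set Implicit Arguments.
Unset Strict Implicit.
Unset Printing Implicit Defensive.

Import Order.TTheory GRing.Theory Num.Theory.
Import numFieldNormedType.Exports.

Local Open Scope classical_set_scope.
Local Open Scope ring_scope.

(* In [ring_scope] this notation would be the formal derivative of polynomials. *)
Local Notation "f ^` ()" := (derive1 f) : ring_scope.

Section norm11.
Variable R : realType.
Notation mu := (@lebesgue_measure R).
Implicit Types u v w : R -> R.

(* The real-valued [sup] and integrals take junk values when infinite; they are
   finite on differences of elements of D(R): see [diffeo_sub_H11] and
   [H11_ubound]. *)
Definition norm11 u : R :=
  sup (range (fun x => `|u x|)) + sup (range (fun x => `|u^`() x|))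
  + Num.sqrt (\int[mu]_x (u x ^+ 2) + \int[mu]_x (u^`() x ^+ 2)).

Definition sqi u := (\int[mu]_x (u x ^+ 2)%:E < +oo)%E.

Record H11 u : Prop := {
  H11_derivable : forall x, derivable u x 1;
  H11_continuous : continuous u^`();
  H11_bounded : exists M : R, forall x, `|u^`() x| <= M;
  H11_sqi : sqi u;
  H11_dsqi : sqi u^`() }.

Lemma derivable_cont u : (forall x, derivable u x 1) -> continuous u.
Proof. by move=> du x; exact/differentiable_continuous/derivable1_diffP/du. Qed.

Lemma measurable_sqr u : continuous u ->
  measurable_fun setT (EFin \o (fun x => u x ^+ 2)).
Proof.
move=> cu; apply/measurable_EFinP/measurable_funX.
exact: continuous_measurable_fun.
Qed.

Lemma sqi_integrable u : continuous u -> sqi u ->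
  mu.-integrable setT (EFin \o (fun x => u x ^+ 2)).
Proof.
move=> cu su; apply/integrableP; split; first exact: measurable_sqr.
by under eq_integral do rewrite /= ger0_norm ?sqr_ge0//.
Qed.

Lemma sqi_integrableZ u k : continuous u -> sqi u ->
  mu.-integrable setT (EFin \o (fun x => k * u x ^+ 2)).
Proof.
move=> cu su; have := integrableZl measurableT k (sqi_integrable cu su).
by apply: eq_integrable.
Qed.

Lemma le_integral_lty (h1 h2 : R -> R) k : continuous h1 -> continuous h2 ->
  0 <= k -> (forall x, 0 <= h1 x) -> (forall x, 0 <= h2 x) ->
  (forall x, h1 x <= k * h2 x) ->
  (\int[mu]_x (h2 x)%:E < +oo -> \int[mu]_x (h1 x)%:E < +oo)%E.
Proof.
move=> c1 c2 k0 h10 h20 h12 h2oo.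
have m1 : measurable_fun setT (EFin \o h1).
  by apply/measurable_EFinP; exact: continuous_measurable_fun.
have m2 : measurable_fun setT (EFin \o h2).
  by apply/measurable_EFinP; exact: continuous_measurable_fun.
apply: (@le_lt_trans _ _ (\int[mu]_x (k%:E * (h2 x)%:E)))%E.
  apply: ge0_le_integral => //.
  - by move=> x _; rewrite lee_fin.
  - exact: measurable_funeM.
  - by move=> x _; rewrite -EFinM lee_fin.
rewrite ge0_integralZl_EFin//; first by rewrite lte_mul_pinfty.
by move=> x _; rewrite lee_fin.
Qed.

Lemma sqiB u v : continuous u -> continuous v -> sqi u -> sqi v ->
  sqi (fun x => u x - v x).
Proof.
move=> cu cv su sv; rewrite /sqi.
apply: (@le_lt_trans _ _
    (\int[mu]_x (2%:E * (u x ^+ 2)%:E + 2%:E * (v x ^+ 2)%:E)))%E.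
  apply: ge0_le_integral => //.
  - by move=> x _; rewrite lee_fin sqr_ge0.
  - by apply: measurable_sqr => x; apply: cvgB; [exact: cu|exact: cv].
  - by apply: emeasurable_funD; apply: measurable_funeM; exact: measurable_sqr.
  - move=> x _; rewrite -!EFinM -EFinD lee_fin.
    by have := sqr_ge0 (u x + v x); nra.
rewrite ge0_integralD//.
- rewrite !ge0_integralZl_EFin//.
  + by rewrite lte_add_pinfty// lte_mul_pinfty.
  + by move=> x _; rewrite lee_fin sqr_ge0.
  + exact: measurable_sqr.
  + by move=> x _; rewrite lee_fin sqr_ge0.
  + exact: measurable_sqr.
- by move=> x _; rewrite -EFinM lee_fin mulr_ge0// sqr_ge0.
- by apply: measurable_funeM; exact: measurable_sqr.
- by move=> x _; rewrite -EFinM lee_fin mulr_ge0// sqr_ge0.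
- by apply: measurable_funeM; exact: measurable_sqr.
Qed.

Lemma derive1B_fun u v : (forall x, derivable u x 1) ->
  (forall x, derivable v x 1) ->
  (fun x => u x - v x)^`() = (fun x => u^`() x - v^`() x).
Proof.
by move=> du dv; apply/funext => x; rewrite !derive1E; exact: deriveB.
Qed.

Lemma H11B u v : H11 u -> H11 v -> H11 (fun x => u x - v x).
Proof.
move=> [du cu [M uM] su sdu] [dv cv [N vN] sv sdv]; split.
- by move=> x; exact: derivableB.
- by rewrite derive1B_fun// => x; apply: cvgB; [exact: cu|exact: cv].
- exists (M + N) => x; rewrite derive1B_fun//.
  by rewrite (le_trans (ler_normB _ _))// lerD.
- by apply: sqiB => //; exact: derivable_cont.
- have sduv := sqiB cu cv sdu sdv.
  by rewrite (derive1B_fun du dv).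
Qed.

Lemma lipschitz u M : (forall x, derivable u x 1) ->
  (forall x, `|u^`() x| <= M) -> forall x y, `|u x - u y| <= M * `|x - y|.
Proof.
move=> du uM x y; wlog xy : x y / y <= x => [H|].
  by have [/H//|/ltW/H] := leP y x; rewrite distrC (distrC x).
have [||c _ ->] := @MVT_segment R u u^`() y x xy.
- by move=> z _; rewrite derive1E; apply: derivableP.
- by apply: continuous_subspaceT; exact: derivable_cont.
- by rewrite normrM ler_wpM2r.
Qed.

Lemma H11_ubound u : H11 u -> exists M : R, forall x, `|u x| <= M.
Proof.
move=> [du cu [L uL] su _].
have L0 : 0 <= L by rewrite (le_trans _ (uL 0)).
pose I := fine (\int[mu]_x (u x ^+ 2)%:E).
have I0 : 0 <= I by apply: fine_ge0; apply: integral_ge0 => x _; rewrite lee_fin sqr_ge0.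
exists (L + I + 1) => x; rewrite leNgt; apply/negP => ux.
have cu' := derivable_cont du.
pose J : set R := `[x, x + 1]%classic.
have mJ : measurable J by exact: measurable_itv.
suff : ((I + 1) ^+ 2 <= I) by nra.
rewrite -lee_fin {2}/I fineK; last first.
  rewrite ge0_fin_numE//; apply: integral_ge0 => y _; by rewrite lee_fin sqr_ge0.
apply: (@le_trans _ _ (\int[mu]_(y in J) (u y ^+ 2)%:E)%E); last first.
  apply: ge0_subset_integral => //.
  - exact: measurable_sqr.
  - by move=> y _; rewrite lee_fin sqr_ge0.
have -> : ((I + 1) ^+ 2)%:E = (\int[mu]_(y in J) ((I + 1) ^+ 2)%:E)%E.
  rewrite integral_cst//= lebesgue_measure_itv/= lte_fin ltrDl ltr01.
  by rewrite -EFinD -EFinM; congr EFin; ring.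
apply: ge0_le_integral => //.
- by move=> y _; rewrite lee_fin sqr_ge0.
- by apply: measurable_funTS; exact: measurable_sqr.
- move=> y; rewrite /J/= in_itv/= => /andP[xy yx]; rewrite lee_fin.
  rewrite -(real_normK (num_real (u y))) lerXn2r ?nnegrE//.
    by rewrite addr_ge0.
  have := lipschitz du uL x y.
  have : `|x - y| <= 1 by rewrite distrC ger0_norm; lra.
  have := ler_distD (u y) (u x) 0; rewrite !subr0 => H1 H2 H3.
  have : L * `|x - y| <= L by rewrite ler_piMr.
  by move: ux H1 H2 H3; lra.
Qed.

Let has_sup_abs u M : (forall x, `|u x| <= M) ->
  has_sup (range (fun x => `|u x|)).
Proof.
move=> uM; split; first by exists `|u 0|, 0.
by exists M => _ [x _ <-].
Qed.

Lemma le_sup_abs u M x : (forall x, `|u x| <= M) ->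
  `|u x| <= sup (range (fun x => `|u x|)).
Proof. by move=> /has_sup_abs[_ ub]; apply: ub_le_sup => //; exists x. Qed.

Lemma sup_abs_triangle u v w M N : (forall x, `|u x| <= M) ->
  (forall x, `|v x| <= N) -> (forall x, w x = u x + v x) ->
  sup (range (fun x => `|w x|)) <=
  sup (range (fun x => `|u x|)) + sup (range (fun x => `|v x|)).
Proof.
move=> uM vN wuv; apply: ge_sup; first by exists `|w 0|, 0.
move=> _ [x _ <-]; rewrite wuv (le_trans (ler_normD _ _))//.
by apply: lerD; [apply: le_sup_abs uM|apply: le_sup_abs vN].
Qed.

Lemma Rintegral_sqrD u v w t : continuous u -> continuous v -> sqi u -> sqi v ->
  0 < t -> (forall x, w x = u x + v x) ->
  \int[mu]_x (w x ^+ 2) <= (1 + t) * \int[mu]_x (u x ^+ 2)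
                           + (1 + t^-1) * \int[mu]_x (v x ^+ 2).
Proof.
move=> cu cv su sv t0 wuv.
have iu := sqi_integrable cu su; have iv := sqi_integrable cv sv.
rewrite -!RintegralZl// -RintegralD//; [|exact: sqi_integrableZ|exact: sqi_integrableZ].
have i2 : mu.-integrable setT (EFin \o (fun x =>
    (1 + t) * (u x ^+ 2) + (1 + t^-1) * (v x ^+ 2))).
  have := integrableD measurableT (sqi_integrableZ (1 + t) cu su)
    (sqi_integrableZ (1 + t^-1) cv sv).
  by apply: eq_integrable.
have key x : w x ^+ 2 <= (1 + t) * (u x ^+ 2) + (1 + t^-1) * (v x ^+ 2).
  rewrite wuv -subr_ge0.
  have -> : (1 + t) * u x ^+ 2 + (1 + t^-1) * v x ^+ 2 - (u x + v x) ^+ 2 =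
            t * (u x - t^-1 * v x) ^+ 2 by field; rewrite gt_eqF.
  by rewrite mulr_ge0 ?sqr_ge0// ltW.
apply: le_Rintegral => //.
apply: le_integrable i2 => //.
  have -> : w = (fun x => u x + v x) by apply/funext.
  by apply: measurable_sqr => x; apply: cvgD; [exact: cu|exact: cv].
move=> x _ /=; rewrite lee_fin ger0_norm ?sqr_ge0// ger0_norm ?key//.
by rewrite (le_trans _ (key x))// sqr_ge0.
Qed.

Lemma norm11_triangle u v w : H11 u -> H11 v -> (forall x, w x = u x + v x) ->
  norm11 w <= norm11 u + norm11 v.
Proof.
move=> Hu Hv wuv.
have [Mu uM] := H11_ubound Hu; have [Mv vM] := H11_ubound Hv.
case: Hu => du cu [Nu uN] su sdu; case: Hv => dv cv [Nv vN] sv sdv.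
have dwuv x : w^`() x = u^`() x + v^`() x.
  by have -> : w = u + v by [apply/funext]; rewrite !derive1E; exact: deriveD.
have s1 := sup_abs_triangle uM vM wuv.
have s2 := sup_abs_triangle uN vN dwuv.
rewrite /norm11.
set A := _ + \int[mu]_x (w^`() x ^+ 2).
set B := _ + \int[mu]_x (u^`() x ^+ 2).
set C := _ + \int[mu]_x (v^`() x ^+ 2).
have B0 : 0 <= B by apply: addr_ge0; apply: Rintegral_ge0 => x _; exact: sqr_ge0.
have C0 : 0 <= C by apply: addr_ge0; apply: Rintegral_ge0 => x _; exact: sqr_ge0.
suff {s1 s2} sABC : Num.sqrt A <= Num.sqrt B + Num.sqrt C.
  rewrite addrACA; apply: lerD sABC.
  by rewrite addrACA; exact: lerD s1 s2.
have key t : 0 < t -> A <= (1 + t) * B + (1 + t^-1) * C.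
  move=> t0; rewrite /A /B /C.
  rewrite !(mulrDr (1 + _)) addrACA; apply: lerD.
    exact: Rintegral_sqrD (derivable_cont du) (derivable_cont dv) su sv t0 wuv.
  exact: Rintegral_sqrD cu cv sdu sdv t0 dwuv.
move: A B C B0 C0 key => A B C B0 C0 key.
apply/ler_addgt0Pr => e e0.
set p := Num.sqrt B; set q := Num.sqrt C.
have p0 : 0 <= p by exact: sqrtr_ge0.
have q0 : 0 <= q by exact: sqrtr_ge0.
have -> : p + q + e = (p + e / 2) + (q + e / 2) by field.
set p' := p + e / 2; set q' := q + e / 2.
have p'0 : 0 < p' by rewrite /p'; lra.
have q'0 : 0 < q' by rewrite /q'; lra.
have Bp : B <= p' ^+ 2.
  by rewrite -(sqr_sqrtr B0) lerXn2r ?nnegrE ?(ltW p'0)// lerDl divr_ge0// ltW.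
have Cq : C <= q' ^+ 2.
  by rewrite -(sqr_sqrtr C0) lerXn2r ?nnegrE ?(ltW q'0)// lerDl divr_ge0// ltW.
have -> : p' + q' = Num.sqrt ((p' + q') ^+ 2).
  by rewrite sqrtr_sqr gtr0_norm// addr_gt0.
apply: ler_wsqrtr.
apply: (le_trans (key (q' / p') (divr_gt0 q'0 p'0))).
have -> : (p' + q') ^+ 2 =
    (1 + q' / p') * p' ^+ 2 + (1 + (q' / p')^-1) * q' ^+ 2.
  by field; rewrite !gt_eqF.
by apply: lerD; apply: ler_wpM2l => //;
  rewrite addr_ge0// ?invr_ge0// divr_ge0// ltW.
Qed.

Lemma sup_abs_ge0 u : 0 <= sup (range (fun x => `|u x|)).
Proof.
have [us|nus] := pselect (has_sup (range (fun x => `|u x|))).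
  apply: (le_trans (normr_ge0 (u 0))).
  by apply: ub_le_sup; [case: us|exists 0].
by rewrite sup_out.
Qed.

Lemma norm11_eq0 u : H11 u -> norm11 u = 0 -> u = (fun=> 0).
Proof.
move=> Hu u0; have [M uM] := H11_ubound Hu; apply/funext => x.
apply/eqP; rewrite -normr_le0 (le_trans (le_sup_abs x uM))//.
move/eqP: u0; rewrite /norm11 paddr_eq0 ?addr_ge0 ?sup_abs_ge0 ?sqrtr_ge0//.
by rewrite paddr_eq0 ?sup_abs_ge0// => /andP[/andP[/eqP-> _] _].
Qed.

Lemma sup_abs0 : sup (range (fun x : R => `|0 : R|)) = 0.
Proof.
have -> : range (fun x : R => `|0 : R|) = [set 0]; last exact: sup1.
by rewrite normr0; apply/seteqP; split => [_ [x _ <-]//|_ ->]; exists 0.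
Qed.

Lemma norm110 : norm11 (fun=> 0) = 0.
Proof.
have -> : norm11 (fun=> 0) =
    sup (range (fun x : R => `|0 : R|)) + sup (range (fun x : R => `|0 : R|)) +
    Num.sqrt (\int[mu]_x (0 ^+ 2) + \int[mu]_x (0 ^+ 2)).
  rewrite /norm11; have -> : (fun=> 0 : R)^`() = (fun=> 0 : R); last by [].
  by apply/funext => x; rewrite derive1_cst.
rewrite sup_abs0 /Rintegral expr0n/= integral0/= !addr0 add0r.
exact: sqrtr0.
Qed.

Lemma norm11N u v : (forall x, derivable u x 1) -> (forall x, v x = - u x) ->
  norm11 v = norm11 u.
Proof.
move=> du vu.
have dvu x : v^`() x = - u^`() x.
  have -> : v = - u by apply/funext => y; rewrite vu.
  by rewrite !derive1E deriveN.
have e1 : (fun x => `|v x|) = (fun x => `|u x|).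
  by apply/funext => x; rewrite vu normrN.
have e2 : (fun x => `|v^`() x|) = (fun x => `|u^`() x|).
  by apply/funext => x; rewrite dvu normrN.
have e3 : (fun x => v x ^+ 2) = (fun x => u x ^+ 2).
  by apply/funext => x; rewrite vu sqrrN.
have e4 : (fun x => v^`() x ^+ 2) = (fun x => u^`() x ^+ 2).
  by apply/funext => x; rewrite dvu sqrrN.
by rewrite /norm11 e1 e2 e3 e4.
Qed.

End norm11.

Section diffeo.
Variable R : realType.
Notation mu := (@lebesgue_measure R).

(* f belongs to D(R) *)
Record is_diffeo (f : R -> R) : Prop := {
  diffeo_derivable : forall x, derivable f x 1;
  diffeo_continuous_derive : continuous f^`();
  diffeo_bounds : exists a b : R, [/\ 0 < a, a < b & forall x, a <= f^`() x <= b];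
  diffeo_L2 : (\int[mu]_x (`|f x - x| ^+ 2)%:E < +oo)%E;
  diffeo_derive_L2 : (\int[mu]_x (`|f^`() x - 1| ^+ 2)%:E < +oo)%E;
  diffeo_derive_cvgy : f^`() x @[x --> +oo] --> (1 : R);
  diffeo_derive_cvgNy : f^`() x @[x --> -oo] --> (1 : R) }.

Record diffeo := Diffeo { diffeo_fun :> R -> R; diffeoP : is_diffeo diffeo_fun }.

HB.instance Definition _ := gen_eqMixin diffeo.
HB.instance Definition _ := gen_choiceMixin diffeo.

Lemma diffeo_eq (f g : diffeo) : f =1 g -> f = g.
Proof.
case: f g => [f fP] [g gP] /= /funext fg; case: _ / fg in gP *.
by congr Diffeo; exact: Prop_irrelevance.
Qed.

Lemma diffeo_cont (f : diffeo) : continuous f.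
Proof. by apply: derivable_cont; case: (diffeoP f). Qed.

Lemma derive1_subid (f : R -> R) : (forall x, derivable f x 1) ->
  (fun x => f x - x)^`() = (fun x => f^`() x - 1).
Proof.
move=> df; rewrite (derive1B_fun df (fun x => @derivable_id _ _ x 1)).
by apply/funext => x; rewrite derive1_id.
Qed.

Lemma diffeo_id_H11 (f : diffeo) : H11 (fun x => f x - x).
Proof.
case: (diffeoP f) => df cf [a [b [a0 ab fab]]] L dL _ _; split.
- by move=> x; apply: derivableB.
- by rewrite derive1_subid// => x; apply: cvgB; [exact: cf|exact: cvg_cst].
- exists (b + 1) => x; rewrite derive1_subid// ler_norml.
  by case/andP: (fab x) => ? ?; apply/andP; split; lra.
- by move: L; rewrite /sqi; under eq_integral do rewrite real_normK ?num_real//.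
- rewrite derive1_subid// /sqi; move: dL.
  by under eq_integral do rewrite real_normK ?num_real//.
Qed.

Lemma diffeo_sub_H11 (f g : diffeo) : H11 (fun x => f x - g x).
Proof.
have := H11B (diffeo_id_H11 f) (diffeo_id_H11 g).
by congr H11; apply/funext => x; ring.
Qed.

Definition diffeo_dist (f g : diffeo) : R := norm11 (fun x => f x - g x).

Lemma diffeo_distxx f : diffeo_dist f f = 0.
Proof.
rewrite /diffeo_dist; have -> : (fun x => f x - f x) = (fun=> 0 : R).
  by apply/funext => x; rewrite subrr.
exact: norm110.
Qed.

Lemma diffeo_dist_eq0 f g : diffeo_dist f g = 0 -> f = g.
Proof.
move=> /(norm11_eq0 (diffeo_sub_H11 f g)) fg; apply: diffeo_eq => x.
by apply/eqP; rewrite -subr_eq0; apply/eqP; exact: (congr1 (fun h => h x) fg).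
Qed.

Lemma diffeo_dist_sym f g : diffeo_dist f g = diffeo_dist g f.
Proof.
apply: norm11N; first by case: (diffeo_sub_H11 g f).
by move=> x; rewrite opprB.
Qed.

Lemma diffeo_dist_triangle g f h :
  diffeo_dist f h <= diffeo_dist f g + diffeo_dist g h.
Proof.
apply: norm11_triangle; [exact: diffeo_sub_H11|exact: diffeo_sub_H11|].
by move=> x; ring.
Qed.

HB.instance Definition _ := @isMetric.Build R diffeo diffeo_dist
  diffeo_distxx diffeo_dist_eq0 diffeo_dist_sym diffeo_dist_triangle.

Lemma diffeo_mdistE (f g : diffeo) : mdist f g = norm11 (fun x => f x - g x).
Proof. by []. Qed.

Lemma diffeo_lt (f : diffeo) : {homo f : x y / x < y}.
Proof.
move=> x y xy; case: (diffeoP f) => df cf [a [b [a0 ab fab]]] _ _ _ _.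
have [||c _ fyx] := @MVT R f f^`() x y xy.
- by move=> z _; rewrite derive1E; apply: derivableP.
- by apply: continuous_subspaceT; exact: diffeo_cont.
- rewrite -subr_gt0 fyx mulr_gt0 ?subr_gt0//.
  by case/andP: (fab c) => /(lt_le_trans a0).
Qed.

Lemma diffeo_inj (f : diffeo) : injective f.
Proof.
move=> x y fxy; apply/eqP; case: ltgtP => // /(diffeo_lt f); by rewrite fxy ltxx.
Qed.

Lemma diffeo_near_id (f : diffeo) : exists2 C, 0 <= C & forall x, `|f x - x| <= C.
Proof.
have [C fC] := H11_ubound (diffeo_id_H11 f).
by exists C => //; rewrite (le_trans _ (fC 0)).
Qed.

Lemma diffeo_surj (f : diffeo) y : exists x, f x = y.
Proof.
have [C C0 fC] := diffeo_near_id f.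
have [|||x _ fx] := @IVT R f (y - C) (y + C) y.
- by lra.
- by apply: continuous_subspaceT; exact: diffeo_cont.
- have := fC (y - C); have := fC (y + C); rewrite !ler_norml => /andP[? ?] /andP[? ?].
  by rewrite ge_min le_max; apply/andP; split; apply/orP; [left|right]; lra.
- by exists x.
Qed.

Definition diffeo_inv_fun (f : diffeo) : R -> R := 'pinv_(fun=> 0) setT f.

Lemma diffeo_inv_funK (f : diffeo) : cancel f (diffeo_inv_fun f).
Proof.
by move=> x; apply: pinvKV; rewrite ?inE// => y z _ _; exact: diffeo_inj.
Qed.

Lemma diffeo_inv_funKV (f : diffeo) : cancel (diffeo_inv_fun f) f.
Proof.
move=> y; apply: pinvK; rewrite inE; have [x fx] := diffeo_surj f y.
by exists x.
Qed.

Lemma diffeo_derive_gt0 (f : diffeo) x : 0 < f^`() x.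
Proof.
case: (diffeoP f) => _ _ [a [b [a0 ab fab]]] _ _ _ _.
by case/andP: (fab x) => /(lt_le_trans a0).
Qed.

Lemma is_derive_diffeo_inv (f : diffeo) (y : R) :
  is_derive y (1 : R) (diffeo_inv_fun f) (f^`() (diffeo_inv_fun f y))^-1.
Proof.
rewrite -{1}(diffeo_inv_funKV f y); apply: (@is_derive_inverse R f).
- by exists 1 => //= x _; exact: diffeo_inv_funK.
- by exists 1 => //= x _; exact: diffeo_cont.
- by rewrite derive1E; apply: derivableP; case: (diffeoP f).
- by rewrite gt_eqF// diffeo_derive_gt0.
Qed.

Lemma derive1_diffeo_inv (f : diffeo) :
  (diffeo_inv_fun f)^`() = (fun y => (f^`() (diffeo_inv_fun f y))^-1).
Proof.
apply/funext => y; rewrite derive1E.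
by case: (is_derive_diffeo_inv f y).
Qed.

Lemma near_id_cvgy (g : R -> R) C : (forall x, `|g x - x| <= C) ->
  g x @[x --> +oo] --> +oo.
Proof.
move=> gC; apply/cvgryPge => A; exists (A + C); split; first exact: num_real.
by move=> x Ax; have := gC x; rewrite ler_norml => /andP[? ?]; lra.
Qed.

Lemma near_id_cvgNy (g : R -> R) C : (forall x, `|g x - x| <= C) ->
  g x @[x --> -oo] --> -oo.
Proof.
move=> gC; apply/cvgrNyPle => A; exists (A - C); split; first exact: num_real.
by move=> x Ax; have := gC x; rewrite ler_norml => /andP[? ?]; lra.
Qed.

Lemma diffeo_substitution (f : diffeo) (G : R -> R) : continuous G ->
  (forall x, 0 <= G x) ->
  (\int[mu]_x (G x)%:E = \int[mu]_x (G (f x) * f^`() x)%:E)%E.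
Proof.
move=> cG G0; have [C _ fC] := diffeo_near_id f.
case: (diffeoP f) => df cf _ _ _ fy fNy.
rewrite (@increasing_ge0_integration_by_substitutionT R f G)//.
- exact: diffeo_lt.
- by apply: cvgP fNy.
- by apply: cvgP fy.
- exact: near_id_cvgNy fC.
- exact: near_id_cvgy fC.
Qed.

Lemma continuous_sqr_norm (u : R -> R) : continuous u ->
  continuous (fun x => `|u x| ^+ 2).
Proof.
move=> cu x; apply: (@continuous_comp _ _ _ (fun y => `|u y|) (fun z => z ^+ 2)).
  by apply: cvg_norm; exact: cu.
exact: exprn_continuous.
Qed.

Lemma is_diffeo_inv (f : diffeo) : is_diffeo (diffeo_inv_fun f).
Proof.
have [C C0 fC] := diffeo_near_id f.
have gC y : `|diffeo_inv_fun f y - y| <= C.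
  by rewrite -{2}(diffeo_inv_funKV f y) distrC.
have dg y : derivable (diffeo_inv_fun f) y 1.
  by case: (is_derive_diffeo_inv f y).
have cg := derivable_cont dg.
have cfg : continuous (fun y => f^`() (diffeo_inv_fun f y)).
  move=> y; apply: continuous_comp; first exact: cg.
  by case: (diffeoP f) => _ + _ _ _ _ _; apply.
have cdg : continuous (diffeo_inv_fun f)^`().
  rewrite derive1_diffeo_inv => y; apply: cvgV; last exact: cfg.
  by rewrite gt_eqF// diffeo_derive_gt0.
have f'0 := diffeo_derive_gt0 f.
have cmf : continuous (fun x => f x - x).
  by move=> x; apply: cvgB; [exact: diffeo_cont|exact: cvg_id].
case: (diffeoP f) => df cf [a [b [a0 ab fab]]] L dL fy fNy.
have b0 : 0 < b by exact: lt_trans ab.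
have cf1 : continuous (fun x => f^`() x - 1).
  by move=> x; apply: cvgB; [exact: cf|exact: cvg_cst].
split; [exact: dg|exact: cdg| | | | |].
- exists b^-1, a^-1; split; rewrite ?invr_gt0 ?ltf_pV2//.
  move=> x; rewrite derive1_diffeo_inv.
  case/andP: (fab (diffeo_inv_fun f x)) => ax xb.
  by rewrite !lef_pV2 ?posrE// ax xb.
- have -> : (\int[mu]_x (`|diffeo_inv_fun f x - x| ^+ 2)%:E =
               \int[mu]_x (`|f x - x| ^+ 2 * f^`() x)%:E)%E.
    rewrite (@diffeo_substitution f (fun x => `|diffeo_inv_fun f x - x| ^+ 2)).
    + by apply: eq_integral => x _; rewrite diffeo_inv_funK distrC.
    + by apply: continuous_sqr_norm => x; apply: cvgB; [exact: cg|exact: cvg_id].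
    + by move=> x; rewrite exprn_ge0.
  apply: (@le_integral_lty _ _ (fun x => `|f x - x| ^+ 2) b) L.
  + by move=> x; apply: cvgM; [exact: (continuous_sqr_norm cmf)|exact: cf].
  + exact: continuous_sqr_norm.
  + exact: ltW.
  + by move=> x; rewrite mulr_ge0 ?exprn_ge0// ltW.
  + by move=> x; rewrite exprn_ge0.
  + by move=> x; rewrite mulrC ler_wpM2r ?exprn_ge0//; case/andP: (fab x).
- have -> : (\int[mu]_x (`|(diffeo_inv_fun f)^`() x - 1| ^+ 2)%:E =
               \int[mu]_x (`|f^`() x - 1| ^+ 2 * (f^`() x)^-1)%:E)%E.
    rewrite (@diffeo_substitution f
      (fun x => `|(diffeo_inv_fun f)^`() x - 1| ^+ 2)).
    + apply: eq_integral => x _; rewrite derive1_diffeo_inv diffeo_inv_funK.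
      congr EFin; rewrite !real_normK ?num_real//.
      by field; rewrite gt_eqF.
    + by apply: continuous_sqr_norm => x; apply: cvgB; [exact: cdg|exact: cvg_cst].
    + by move=> x; rewrite exprn_ge0.
  apply: (@le_integral_lty _ _ (fun x => `|f^`() x - 1| ^+ 2) a^-1) dL.
  + move=> x; apply: cvgM; first exact: (continuous_sqr_norm cf1).
    by apply: cvgV; [rewrite gt_eqF|exact: cf].
  + exact: continuous_sqr_norm.
  + by rewrite invr_ge0 ltW.
  + by move=> x; rewrite mulr_ge0 ?exprn_ge0// invr_ge0 ltW.
  + by move=> x; rewrite exprn_ge0.
  + move=> x; rewrite mulrC ler_wpM2r ?exprn_ge0//.
    by rewrite lef_pV2 ?posrE//; case/andP: (fab x).
- rewrite derive1_diffeo_inv -(invr1 R); apply: cvgV; first exact: oner_neq0.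
  by apply: cvg_comp fy; exact: near_id_cvgy gC.
- rewrite derive1_diffeo_inv -(invr1 R); apply: cvgV; first exact: oner_neq0.
  by apply: cvg_comp fNy; exact: near_id_cvgNy gC.
Qed.

Definition diffeo_inv (f : diffeo) : diffeo := Diffeo (is_diffeo_inv f).

Lemma diffeo_invK (f : diffeo) : cancel f (diffeo_inv f). Proof. exact: diffeo_inv_funK. Qed.
Lemma diffeo_invKV (f : diffeo) : cancel (diffeo_inv f) f. Proof. exact: diffeo_inv_funKV. Qed.

End diffeo.

(* Main.v *)
Require Import Defs.
From mathcomp Require Import all_boot all_order all_algebra.
From mathcomp Require Import ring lra.
From mathcomp Require Import all_classical all_reals all_analysis measurable_realfun.

(** Fix [f] with [a <= f' <= b], let [g] be [C^1]-close to [f] (so that the same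
    bounds, slightly loosened, hold for [g]), and write [h], [k] for the inverses
    of [f] and [g]. Everything is compared at the point [k y], where
    [y = g (k y)].

    Since [h] is [a^-1]-Lipschitz and [k y = h (f (k y))],
    [|h y - k y| <= a^-1 |f (k y) - g (k y)|]; and [h' y - k' y] is a difference
    of reciprocals of [f' (h y)] and [g' (k y)], so that
    [|h' y - k' y| <= a^-2 (|f' (h y) - f' (k y)| + |f' (k y) - g' (k y)|)].
    In both bounds the terms containing [f - g] at [k y] are harmless: their sup
    is at most that of [f - g] or [f' - g'], and their [L^2] norm is controlled
    by the substitution [y = g x], which costs a factor [sup g' <= b]
    ([integral_comp_inv_le]).

    There remains [f' o h - f' o k], in which [f'] is evaluated at two uniformly
    close points. It is uniformly small because [f'], being continuous with
    limits at infinity, is uniformly continuous ([unif_continuous_of_limits]).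
    For the [L^2] norm ([comp_inv_L2_close]) put [w = f' - 1], a
    square-integrable function that vanishes at infinity, and let [t <= 1]. On a
    large interval uniform continuity is enough; off that interval [|w| <= t] at
    both points, so that the integrand is at most [2 W (h y) + 2 W (k y)] with
    [W = min (w^2, t)]. By substitution the integrals of [W o h] and [W o k] are
    at most [b] times that of [W], which tends to 0 with [t] by dominated
    convergence ([integral_min_small]). Using the continuous truncation [W]
    instead of the indicator of the complement of an interval lets the change of
    variables apply to it directly. *)

Set Implicit Arguments.
Unset Strict Implicit.
Unset Printing Implicit Defensive.

Import Order.TTheory GRing.Theory Num.Theory.
Import numFieldNormedType.Exports.

Local Open Scope classical_set_scope.
Local Open Scope ring_scope.

(* In [ring_scope] this notation would be the formal derivative of polynomials. *)
Local Notation "f ^` ()" := (derive1 f) : ring_scope.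

(** * Functions on the line *)

Section real_functions.
Variable R : realType.
Notation mu := (@lebesgue_measure R).
Implicit Types u v w : R -> R.

Lemma limit_at_infinity_tail u (l e : R) : u x @[x --> +oo] --> l ->
  u x @[x --> -oo] --> l -> 0 < e ->
  exists2 N, 0 <= N & forall x, N < `|x| -> `|u x - l| <= e.
Proof.
move=> /cvgrPdist_le uy /cvgrPdist_le uNy e0.
have [A [_ uA]] := uy _ e0; have [B [_ uB]] := uNy _ e0.
exists (`|A| + `|B|) => [|x ABx]; first by rewrite addr_ge0.
have := ler_norm A; have := ler_norm (- B); rewrite normrN => ? ?.
have ? := normr_ge0 A; have ? := normr_ge0 B.
rewrite distrC; have [x0|x0] := leP 0 x.
  by apply: uA; rewrite (ger0_norm x0) in ABx; lra.
by apply: uB; rewrite (ltr0_norm x0) in ABx; lra.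
Qed.

(** Heine-Cantor on a segment [[-(N+1), N+1]] takes care of the points in it; a
    point outside of it and any point at distance at most 1 both lie where [u] is
    close to its limit. *)
Lemma unif_continuous_of_limits u (l e : R) : continuous u ->
  u x @[x --> +oo] --> l -> u x @[x --> -oo] --> l -> 0 < e ->
  exists2 d, 0 < d & forall x y, `|x - y| <= d -> `|u x - u y| <= e.
Proof.
move=> cu uy uNy e0; have e20 : 0 < e / 2 by lra.
have [N N0 uN] := limit_at_infinity_tail uy uNy e20.
pose P (d x : R) := forall y, `|x - y| <= d -> `|u x - u y| <= e.
(* Near-covering compactness yields one radius valid on the whole segment, for
   second points [y] that range over the line and not just over the segment. *)
have : compact (`[- (N + 1), N + 1] : set R) by exact: segment_compact.
move=> /compact_near_coveringP /(_ R (0^'+ : set_system R) P _) [].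
  move=> x _.
  have /cvgrPdist_le/(_ _ e20)/nbhs_ballP[r /= r0 ur] := cu x.
  have r20 : 0 < r / 2 by lra.
  exists (ball x (r / 2), [set d | d < r / 2]); first split => /=.
  - exact: nbhsx_ballx.
  - exact: nbhs_right_lt.
  move=> [x' d] /= [xx' dr] y x'y.
  have := ur x'; have := ur y; rewrite /ball/= => Hy Hx.
  rewrite /ball/= in xx'.
  have := ler_distD x' x y => ?.
  have := Hx ltac:(lra); have := Hy ltac:(lra).
  by have := ler_distD (u x) (u x') (u y); rewrite (distrC (u x') (u x)); lra.
move=> d0 /= d00 Pd.
pose d := Num.min 1 (d0 / 2).
have d1 : d <= 1 by rewrite ge_min lexx.
have dd : d <= d0 / 2 by rewrite ge_min lexx orbT.
have dpos : 0 < d by rewrite lt_min ltr01/=; move: d00; rewrite /=; lra.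
exists d => // x y xy.
have [xN|xN] := leP `|x| (N + 1).
  apply: (Pd d) => //=.
    by rewrite sub0r normrN gtr0_norm//; move: d00 => /=; lra.
  by rewrite in_itv/= -ler_norml.
have yN : N < `|y|.
  by have := ler_normD y (x - y); rewrite subrKC; lra.
have := uN x ltac:(lra); have := uN y yN.
by have := ler_distD l (u x) (u y); rewrite (distrC l); lra.
Qed.

(** The truncations [min (w^2, t)] are dominated by [w^2] and tend to 0 with
    [t]. *)
Lemma integral_min_small w e : continuous w -> sqi w -> 0 < e ->
  exists2 t : R, 0 < t <= 1 & (\int[mu]_x (Num.min (w x ^+ 2) t)%:E <= e%:E)%E.
Proof.
move=> cw sw e0.
pose t n : R := n.+1%:R^-1.
have t0 n : 0 < t n by rewrite invr_gt0.
have mw : measurable_fun setT (fun x => w x ^+ 2).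
  by apply/measurable_EFinP; exact: measurable_sqr.
pose F n x := (Num.min (w x ^+ 2) (t n))%:E.
have min_ge0 n x : 0 <= Num.min (w x ^+ 2) (t n) by rewrite le_min sqr_ge0 ltW.
have cvF : (\int[mu]_x F n x)%E @[n --> \oo] --> (\int[mu]_x (cst 0%E x))%E.
  apply: (@dominated_cvg _ _ R mu setT measurableT F (cst 0%E)
           (EFin \o (fun x => w x ^+ 2))) => //.
  - by move=> n; apply/measurable_EFinP; exact: measurable_minr.
  - move=> x _; apply/fine_cvgP; split; first by apply: nearW.
    apply: (@squeeze_cvgr _ _ _ _ (cst 0) t).
    + by near=> n; rewrite /= min_ge0 ge_min lexx orbT.
    + exact: cvg_cst.
    + exact: cvg_harmonic.
  - exact: sqi_integrable.
  - by move=> n x _ /=; rewrite lee_fin ger0_norm ?ge_min ?lexx.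
have : \forall n \near \oo, (\int[mu]_x F n x < e%:E)%E.
  move: cvF; rewrite integral0 => /(_ [set z | (z < e%:E)%E]); apply.
  by apply: open_nbhs_nbhs; split; [exact: open_ereal_lt_ereal|rewrite /= lte_fin].
case=> n _ /(_ n (leqnn n)) /= /ltW Fe.
by exists (t n) => //; rewrite t0/= invf_le1// ler1n.
Unshelve. all: by end_near. Qed.

Lemma sum_sqrt_le (s t p q d : R) : 0 <= s -> 0 <= t -> 0 <= p -> 0 <= q ->
  s + t + Num.sqrt (p + q) <= d -> [/\ s <= d, t <= d, p <= d ^+ 2 & q <= d ^+ 2].
Proof.
move=> s0 t0 p0 q0; have pq0 := addr_ge0 p0 q0.
have := sqr_sqrtr pq0; have := sqrtr_ge0 (p + q).
by move: (Num.sqrt _) => r r0 rpq std; split; nra.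
Qed.

(** Together with [norm11_le], this reduces closeness in the norm, up to a
    constant factor, to four separate estimates. *)
Lemma norm11_bounds u d : H11 u -> norm11 u <= d ->
  [/\ forall x, `|u x| <= d, forall x, `|u^`() x| <= d,
      (\int[mu]_x (u x ^+ 2)%:E <= (d ^+ 2)%:E)%E &
      (\int[mu]_x (u^`() x ^+ 2)%:E <= (d ^+ 2)%:E)%E].
Proof.
move=> Hu; have [M uM] := H11_ubound Hu.
case: Hu => du cu [N uN] su sdu.
have fin v : sqi v -> (\int[mu]_x (v x ^+ 2)%:E)%E \is a fin_num.
  move=> sv; rewrite ge0_fin_numE//; apply: integral_ge0 => y _.
  by rewrite lee_fin sqr_ge0.
move=> /sum_sqrt_le[||||s1 s2 I1 I2]; rewrite ?sup_abs_ge0//.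
- by apply: Rintegral_ge0 => x _; exact: sqr_ge0.
- by apply: Rintegral_ge0 => x _; exact: sqr_ge0.
split.
- by move=> x; exact: le_trans (le_sup_abs x uM) s1.
- by move=> x; exact: le_trans (le_sup_abs x uN) s2.
- by rewrite -(fineK (fin _ su)) lee_fin.
- by rewrite -(fineK (fin _ sdu)) lee_fin.
Qed.

Lemma norm11_le u e : 0 < e ->
  (forall x, `|u x| <= e) -> (forall x, `|u^`() x| <= e) ->
  (\int[mu]_x (u x ^+ 2)%:E <= (e ^+ 2)%:E)%E ->
  (\int[mu]_x (u^`() x ^+ 2)%:E <= (e ^+ 2)%:E)%E -> norm11 u <= 4 * e.
Proof.
move=> e0 ue due iu idu; rewrite /norm11.
have supe v : (forall x, `|v x| <= e) -> sup (range (fun x => `|v x|)) <= e.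
  by move=> ve; apply: ge_sup; [exists `|v 0|, 0|move=> _ [x _ <-]].
have inte v : (\int[mu]_x (v x ^+ 2)%:E <= (e ^+ 2)%:E)%E ->
    \int[mu]_x (v x ^+ 2) <= e ^+ 2.
  move=> iv; rewrite -lee_fin /Rintegral fineK// ge0_fin_numE.
    by rewrite (le_lt_trans iv)// ltry.
  by apply: integral_ge0 => y _; rewrite lee_fin sqr_ge0.
have -> : 4 * e = e + e + 2 * e by ring.
apply: lerD; first by apply: lerD; exact: supe.
rewrite -[leRHS]ger0_norm; last by lra.
rewrite -sqrtr_sqr; apply: ler_wsqrtr.
have -> : (2 * e) ^+ 2 = e ^+ 2 + e ^+ 2 + 2 * e ^+ 2 by ring.
apply: ler_wpDr; first by rewrite mulr_ge0 ?sqr_ge0.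
by apply: lerD; exact: inte.
Qed.

End real_functions.

(** * Comparing the inverses of two diffeomorphisms *)

Section diffeo_inverse.
Variable R : realType.
Notation mu := (@lebesgue_measure R).
Implicit Types f g : diffeo R.

(** The substitution [y = g x] turns the left-hand side into the integral of
    [G * g']. *)
Lemma integral_comp_inv_le g b (G : R -> R) : (forall x, g^`() x <= b) ->
  continuous G -> (forall x, 0 <= G x) ->
  (\int[mu]_y (G (diffeo_inv g y))%:E <= b%:E * \int[mu]_x (G x)%:E)%E.
Proof.
move=> gb cG G0.
have cg : continuous g^`() by case: (diffeoP g).
have b0 : 0 <= b by rewrite (le_trans _ (gb 0))// ltW// diffeo_derive_gt0.
have cGg : continuous (G \o diffeo_inv g).
  by move=> x; apply: continuous_comp; [exact: diffeo_cont|exact: cG].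
rewrite (@diffeo_substitution _ g (G \o diffeo_inv g))//; last first.
  by move=> x; exact: G0.
have mG : measurable_fun setT (EFin \o G).
  by apply/measurable_EFinP; exact: continuous_measurable_fun.
rewrite -ge0_integralZl_EFin//; last by move=> x _; rewrite lee_fin.
under [leLHS]eq_integral do rewrite /comp diffeo_invK.
apply: ge0_le_integral => //.
- by move=> x _; rewrite lee_fin mulr_ge0// ltW// diffeo_derive_gt0.
- apply/measurable_EFinP; apply: measurable_funM; exact: continuous_measurable_fun.
- exact: measurable_funeM.
- by move=> x _; rewrite -EFinM lee_fin mulrC ler_wpM2r.
Qed.

(** With [x = diffeo_inv g y], the two points compared are the images by
    [diffeo_inv f], which is [a^-1]-Lipschitz, of [g x] and [f x]. *)
Lemma inv_dist_le f g a y : 0 < a -> (forall x, a <= f^`() x) ->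
  `|diffeo_inv f y - diffeo_inv g y| <=
  a^-1 * `|f (diffeo_inv g y) - g (diffeo_inv g y)|.
Proof.
move=> a0 fa; rewrite diffeo_invKV distrC.
rewrite -{1}(diffeo_invK f (diffeo_inv g y)).
apply: Defs.lipschitz; first by case: (diffeoP (diffeo_inv f)).
move=> x; rewrite derive1_diffeo_inv normfV gtr0_norm ?diffeo_derive_gt0//.
by rewrite lef_pV2 ?posrE// diffeo_derive_gt0.
Qed.

(** The difference of the reciprocals of [p] and [q], both at least [a], is at most
    [a^-2 |p - q|]; here [p] and [q] involve different functions at different
    points, and [f'] at [diffeo_inv g y] is the intermediate value. *)
Lemma inv_derive_dist_le f g a y : 0 < a -> (forall x, a <= f^`() x) ->
  (forall x, a <= g^`() x) ->
  `|(diffeo_inv f)^`() y - (diffeo_inv g)^`() y| <=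
  a^-1 ^+ 2 * (`|f^`() (diffeo_inv f y) - f^`() (diffeo_inv g y)| +
               `|f^`() (diffeo_inv g y) - g^`() (diffeo_inv g y)|).
Proof.
move=> a0 fa ga; rewrite !derive1_diffeo_inv.
set p := f^`() (diffeo_inv_fun f y); set q := g^`() (diffeo_inv_fun g y).
set r := f^`() (diffeo_inv_fun g y).
have pa : a <= p by exact: fa.
have qa : a <= q by exact: ga.
have p0 : 0 < p by lra.
have q0 : 0 < q by lra.
have -> : p^-1 - q^-1 = p^-1 * q^-1 * (q - p) by field; rewrite !gt_eqF.
rewrite normrM; apply: ler_pM => //.
  rewrite ger0_norm ?mulr_ge0 ?invr_ge0 ?(ltW p0) ?(ltW q0)//.
  by rewrite expr2; apply: ler_pM; rewrite ?invr_ge0 ?(ltW p0) ?(ltW q0)//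
    lef_pV2 ?posrE.
by rewrite distrC ler_distD.
Qed.

(** Composition of a fixed [w] with inverses is continuous into [L^2], for the
    uniform distance of the inverses and under a common bound [b] on the
    derivatives. The bound [e] is spent as [e/2]
    on an interval, by uniform continuity of [w], and [e/4] on each of the two
    tails, bounded through the truncation [W] of [w^2]. *)
Lemma comp_inv_L2_close f b w e : 0 < b -> (forall x, f^`() x <= b) ->
  continuous w -> sqi w ->
  w x @[x --> +oo] --> (0 : R) -> w x @[x --> -oo] --> (0 : R) -> 0 < e ->
  exists2 d, 0 < d & forall g, (forall x, g^`() x <= b) ->
    (forall y, `|diffeo_inv f y - diffeo_inv g y| <= d) ->
    (\int[mu]_y ((w (diffeo_inv f y) - w (diffeo_inv g y)) ^+ 2)%:E <= e%:E)%E.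
Proof.
move=> b0 fb cw sw wy wNy e0.
have be0 : 0 < e / (8 * b) by rewrite divr_gt0// mulr_gt0.
have [t /andP[t0 t1] Wt] := integral_min_small cw sw be0.
pose W x := Num.min (w x ^+ 2) t.
have W0 x : 0 <= W x by rewrite le_min sqr_ge0 ltW.
have cW : continuous W.
  move=> x; apply: (@continuous_min _ _ (fun y => w y ^+ 2) (cst t));
    last exact: cvg_cst.
  apply: (@continuous_comp _ _ _ w (fun z => z ^+ 2)); first exact: cw.
  exact: exprn_continuous.
have [N N0 wN] := limit_at_infinity_tail wy wNy t0.
have WN x : N < `|x| -> w x ^+ 2 = W x.
  move=> /wN; rewrite subr0 => wt; rewrite /W min_l//.
  rewrite -(real_normK (num_real _)).
  by have := normr_ge0 (w x); nra.
have [C C0 hC] := diffeo_near_id (diffeo_inv f).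
(* If [L < |y|] then [h y], at distance at most [C] from [y], is beyond [N + 1];
   hence [k y], at distance at most 1 from [h y], is beyond [N]. *)
pose L := N + C + 1.
have L0 : 0 < L by rewrite /L; lra.
(* The modulus is to satisfy [om^2 * (2 L) <= e/2]; capping it at 1 gives
   [om^2 <= om]. *)
pose om := Num.min 1 (e / (4 * L)).
have eL0 : 0 < e / (4 * L) by rewrite divr_gt0// mulr_gt0.
have om0 : 0 < om by rewrite lt_min ltr01.
have omL : om ^+ 2 * (2 * L) <= e / 2.
  have o1 : om <= 1 by rewrite ge_min lexx.
  have : om <= e / (4 * L) by rewrite ge_min lexx orbT.
  rewrite ler_pdivlMr ?mulr_gt0// => oL.
  have : om ^+ 2 <= om by nra.
  by nra.
have [d d0 wd] := unif_continuous_of_limits cw wy wNy om0.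
exists (Num.min 1 d) => [|g gb fg]; first by rewrite lt_min ltr01.
pose J : set R := `[- L, L]%classic.
have mJ : measurable J by exact: measurable_itv.
set h := diffeo_inv f in hC fg *; set k := diffeo_inv g in fg *.
have key y : (w (h y) - w (k y)) ^+ 2 <=
    om ^+ 2 * \1_J y + (2 * W (h y) + 2 * W (k y)).
  have hk := fg y; rewrite le_min in hk; case/andP: hk => hk1 hkd.
  rewrite indicE; case: (boolP (y \in J)) => yJ.
    rewrite mulr1 -(real_normK (num_real (_ - _))).
    have := wd _ _ hkd; have := normr_ge0 (w (h y) - w (k y)).
    by have := W0 (h y); have := W0 (k y); nra.
  have yL : L < `|y|.
    rewrite ltNge; apply: contra yJ; rewrite ler_norml => yL.
    by rewrite inE /J/= in_itv.
  have hN : N + 1 < `|h y|.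
    have := hC y; have := ler_distD (h y) y 0.
    by rewrite !subr0 distrC; move: yL; rewrite /L; lra.
  have kN : N < `|k y|.
    by have := ler_distD (k y) (h y) 0; rewrite !subr0; lra.
  rewrite mulr0 add0r -!WN//; last by lra.
  by have := sqr_ge0 (w (h y) + w (k y)); nra.
have mWi f' : measurable_fun setT (fun y => (2 * W (diffeo_inv f' y))%:E).
  apply/measurable_EFinP; apply: measurable_funM => //.
  apply: continuous_measurable_fun => x.
  by apply: continuous_comp; [exact: diffeo_cont|exact: cW].
have intW f' : (forall x, f'^`() x <= b) ->
    (\int[mu]_y (2 * W (diffeo_inv f' y))%:E <= (e / 4)%:E)%E.
  move=> f'b; under eq_integral do rewrite EFinM.
  rewrite ge0_integralZl_EFin//; last 2 first.
  - by move=> y _; rewrite lee_fin.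
  - apply/measurable_EFinP; apply: continuous_measurable_fun => x.
    by apply: continuous_comp; [exact: diffeo_cont|exact: cW].
  apply: (@le_trans _ _ (2%:E * (b%:E * (e / (8 * b))%:E))%E).
    apply: lee_wpmul2l; first by rewrite lee_fin.
    apply: (le_trans (integral_comp_inv_le f'b cW W0)).
    by apply: lee_wpmul2l; rewrite // lee_fin ltW.
  rewrite -!EFinM lee_fin le_eqVlt; apply/orP; left; apply/eqP.
  by field; rewrite gt_eqF.
have mI : measurable_fun setT (fun y => (om ^+ 2 * \1_J y)%:E).
  by apply/measurable_EFinP; apply: measurable_funM.
have intJ : (\int[mu]_y (om ^+ 2 * \1_J y)%:E <= (e / 2)%:E)%E.
  under eq_integral do rewrite EFinM.
  rewrite ge0_integralZl_EFin ?sqr_ge0//; last first.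
    by apply/measurable_EFinP.
  rewrite integral_indic//= setIT /J lebesgue_measure_itv/= lte_fin.
  have -> : - L < L by lra.
  rewrite -EFinD -EFinM lee_fin opprK.
  by move: omL; rewrite (_ : 2 * L = L + L)//; ring.
apply: (@le_trans _ _ (\int[mu]_y ((om ^+ 2 * \1_J y)%:E +
    ((2 * W (h y))%:E + (2 * W (k y))%:E)))%E).
  apply: ge0_le_integral => //.
  - by move=> y _; rewrite lee_fin sqr_ge0.
  - apply: measurable_sqr => x; apply: cvgB.
      by apply: continuous_comp; [exact: diffeo_cont|exact: cw].
    by apply: continuous_comp; [exact: diffeo_cont|exact: cw].
  - by do 2 apply: emeasurable_funD => //; exact: mWi.
  - by move=> y _; rewrite -!EFinD lee_fin.
rewrite ge0_integralD//; last 3 first.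
- by move=> y _; rewrite lee_fin mulr_ge0// sqr_ge0.
- by move=> y _; rewrite -EFinD lee_fin addr_ge0// mulr_ge0.
- by apply: emeasurable_funD => //; exact: mWi.
rewrite ge0_integralD//; last 4 first.
- by move=> y _; rewrite lee_fin mulr_ge0.
- exact: mWi.
- by move=> y _; rewrite lee_fin mulr_ge0.
- exact: mWi.
have -> : e%:E = ((e / 2)%:E + ((e / 4)%:E + (e / 4)%:E))%E.
  by rewrite -!EFinD; congr EFin; field.
by apply: leeD => //; apply: leeD; exact: intW.
Qed.

Lemma integral_inv_sub_le f g a b : 0 < a -> (forall x, a <= f^`() x) ->
  (forall x, g^`() x <= b) ->
  (\int[mu]_y ((diffeo_inv f y - diffeo_inv g y) ^+ 2)%:E <=
   (a^-1 ^+ 2 * b)%:E * \int[mu]_x ((f x - g x) ^+ 2)%:E)%E.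
Proof.
move=> a0 fa gb; pose u x := a^-1 * (f x - g x).
have cfg : continuous (fun x => f x - g x).
  by move=> x; apply: cvgB; exact: diffeo_cont.
have cu : continuous u.
  by move=> x; apply: cvgM; [exact: cvg_cst|exact: cfg].
have cu2 : continuous (fun x => u x ^+ 2).
  move=> x; apply: (@continuous_comp _ _ _ u (fun z => z ^+ 2)); first exact: cu.
  exact: exprn_continuous.
apply: (@le_trans _ _ (\int[mu]_y (u (diffeo_inv g y) ^+ 2)%:E)%E).
  apply: ge0_le_integral => //.
  - by move=> y _; rewrite lee_fin sqr_ge0.
  - by apply: measurable_sqr => y; apply: cvgB; exact: diffeo_cont.
  - apply: measurable_sqr => y.
    by apply: continuous_comp; [exact: diffeo_cont|exact: cu].
  - move=> y _; rewrite lee_fin -[leLHS]real_normK ?num_real//.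
    rewrite -[leRHS]real_normK ?num_real// lerXn2r ?nnegrE//.
    rewrite /u normrM (@gtr0_norm _ a^-1) ?invr_gt0//.
    exact: inv_dist_le.
apply: le_trans (integral_comp_inv_le gb cu2 _) _ => [x|]; first exact: sqr_ge0.
under eq_integral do rewrite exprMn EFinM.
rewrite ge0_integralZl_EFin ?sqr_ge0//; last 2 first.
- by move=> x _; rewrite lee_fin sqr_ge0.
- exact: measurable_sqr.
by rewrite muleA -EFinM mulrC.
Qed.

Lemma integral_inv_derive_sub_le f g a b : 0 < a -> (forall x, a <= f^`() x) ->
  (forall x, a <= g^`() x) -> (forall x, g^`() x <= b) ->
  (\int[mu]_y (((diffeo_inv f)^`() y - (diffeo_inv g)^`() y) ^+ 2)%:E <=
   (2 * a^-1 ^+ 4)%:E *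
   (\int[mu]_y ((f^`() (diffeo_inv f y) - f^`() (diffeo_inv g y)) ^+ 2)%:E +
    b%:E * \int[mu]_x ((f^`() x - g^`() x) ^+ 2)%:E))%E.
Proof.
move=> a0 fa ga gb.
have cd f' : continuous f'^`() by case: (diffeoP f').
pose P y := f^`() (diffeo_inv f y) - f^`() (diffeo_inv g y).
pose v x := f^`() x - g^`() x.
have cv : continuous v by move=> x; apply: cvgB; exact: cd.
have cv2 : continuous (fun x => v x ^+ 2).
  move=> x; apply: (@continuous_comp _ _ _ v (fun z => z ^+ 2)); first exact: cv.
  exact: exprn_continuous.
have cvk : continuous (v \o diffeo_inv g).
  by move=> x; apply: continuous_comp; [exact: diffeo_cont|exact: cv].
have cP : continuous P.
  move=> x; apply: cvgB.
    by apply: continuous_comp; [exact: diffeo_cont|exact: cd].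
  by apply: continuous_comp; [exact: diffeo_cont|exact: cd].
apply: (@le_trans _ _ ((2 * a^-1 ^+ 4)%:E *
    \int[mu]_y ((P y ^+ 2)%:E + ((v \o diffeo_inv g) y ^+ 2)%:E))%E).
  rewrite -ge0_integralZl_EFin//; last 3 first.
  - by move=> y _; rewrite -EFinD lee_fin addr_ge0// sqr_ge0.
  - by apply: emeasurable_funD; exact: measurable_sqr.
  - by rewrite mulr_ge0// exprn_ge0// invr_ge0 ltW.
  apply: ge0_le_integral => //.
  - by move=> y _; rewrite lee_fin sqr_ge0.
  - by apply: measurable_sqr => y; apply: cvgB; exact: cd.
  - apply: measurable_funeM.
    by apply: emeasurable_funD; exact: measurable_sqr.
  move=> y _; rewrite -EFinD -EFinM lee_fin.
  have := inv_derive_dist_le y a0 fa ga.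
  rewrite -/(P y) -/(v (diffeo_inv g y)) => D.
  change ((v \o diffeo_inv g) y) with (v (diffeo_inv g y)).
  rewrite -(real_normK (num_real (_ - _))) -(real_normK (num_real (P y))).
  rewrite -(real_normK (num_real (v _))).
  have D0 := normr_ge0 ((diffeo_inv f)^`() y - (diffeo_inv g)^`() y).
  apply: (@le_trans _ _ ((a^-1 ^+ 2 * (`|P y| + `|v (diffeo_inv g y)|)) ^+ 2)).
    by rewrite lerXn2r// nnegrE (le_trans D0).
  have A0 : 0 <= a^-1 ^+ 4 by rewrite exprn_ge0// invr_ge0 ltW.
  have S (p q : R) : (p + q) ^+ 2 <= 2 * (p ^+ 2 + q ^+ 2).
    by have := sqr_ge0 (p - q); nra.
  have := ler_wpM2l A0 (S `|P y| `|v (diffeo_inv g y)|).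
  by rewrite [leRHS]mulrCA [leRHS]mulrA exprMn -exprM.
apply: lee_wpmul2l.
  by rewrite lee_fin mulr_ge0// exprn_ge0// invr_ge0 ltW.
rewrite ge0_integralD//; last 4 first.
- by move=> y _; rewrite lee_fin sqr_ge0.
- exact: measurable_sqr.
- by move=> y _; rewrite lee_fin sqr_ge0.
- exact: measurable_sqr.
apply: leeD => //.
by apply: (integral_comp_inv_le gb cv2) => x; exact: sqr_ge0.
Qed.

(** A distance [d] at most [a], where [2 a] bounds [f'] from below, forces
    [g' >= a]; the other constraints on [d] make each of the four quantities of
    [norm11_le] at most [e] or [e^2]. *)
Lemma diffeo_inv_dist_small f e : 0 < e -> exists2 d, 0 < d &
  forall g, diffeo_dist f g <= d ->
    diffeo_dist (diffeo_inv f) (diffeo_inv g) <= 4 * e.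
Proof.
move=> e0.
case: (diffeoP f) => df cf [a' [b' [a'0 a'b' fab]]] _ dL fy fNy.
pose a := a' / 2; pose b := b' + 1.
have a0 : 0 < a by rewrite /a; lra.
have b0 : 0 < b by rewrite /b; lra.
have fa x : a <= f^`() x by case/andP: (fab x); rewrite /a; lra.
have fb x : f^`() x <= b by case/andP: (fab x); rewrite /b; lra.
(* [om] and [E] are the values for which the bounds of [inv_derive_dist_le] and
   [integral_inv_derive_sub_le], with equal contributions of their two terms, are
   exactly [e] and [e^2]. *)
pose om := a ^+ 2 * e / 2.
have om0 : 0 < om by rewrite divr_gt0// mulr_gt0// exprn_gt0.
have [d1 d10 fd1] := unif_continuous_of_limits cf fy fNy om0.
pose E := a ^+ 4 * e ^+ 2 / 4.
have E0 : 0 < E by rewrite divr_gt0// mulr_gt0// exprn_gt0.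
pose w x := f^`() x - 1.
have cw : continuous w by move=> x; apply: cvgB; [exact: cf|exact: cvg_cst].
have sw : sqi w.
  by case: (diffeo_id_H11 f) => _ _ _ _; rewrite derive1_subid.
have wy : w x @[x --> +oo] --> (0 : R).
  by rewrite -(subrr (1 : R)); apply: cvgB; [exact: fy|exact: cvg_cst].
have wNy : w x @[x --> -oo] --> (0 : R).
  by rewrite -(subrr (1 : R)); apply: cvgB; [exact: fNy|exact: cvg_cst].
have [d2 d20 fd2] := comp_inv_L2_close b0 fb cw sw wy wNy E0.
have dle (x : R) : 0 < x -> \forall d \near 0^'+, d <= x by exact: nbhs_right_le.
near (0 : R)^'+ => d.
have d0 : 0 < d by [].
have d_1 : d <= 1 by near: d; exact: dle.
have d_a : d <= a by near: d; exact: dle.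
have d_ae : d <= a * e by near: d; apply: dle; rewrite mulr_gt0.
have d_om : d <= om by near: d; exact: dle.
have d_ad1 : d <= a * d1 by near: d; apply: dle; rewrite mulr_gt0.
have d_ad2 : d <= a * d2 by near: d; apply: dle; rewrite mulr_gt0.
have d_b : d <= a ^+ 2 * e ^+ 2 / b.
  by near: d; apply: dle; rewrite divr_gt0// mulr_gt0// exprn_gt0.
have d_bE : d <= E / b by near: d; apply: dle; rewrite divr_gt0.
exists d => // g fg.
have [Hs Hds Hi Hdi] := norm11_bounds (diffeo_sub_H11 f g) fg.
have dg : forall x, derivable g x 1 by case: (diffeoP g).
rewrite (derive1B_fun df dg) in Hds Hdi.
have ga x : a <= g^`() x.
  have := Hds x; rewrite ler_norml => /andP[_].
  by case/andP: (fab x); move: d_a; rewrite /a; lra.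
have gb x : g^`() x <= b.
  have := Hds x; rewrite ler_norml => /andP[+ _].
  by case/andP: (fab x); rewrite /b; lra.
have hk y : `|diffeo_inv f y - diffeo_inv g y| <= a^-1 * d.
  apply: le_trans (inv_dist_le g y a0 fa) _.
  by rewrite ler_wpM2l// invr_ge0 ltW.
have ad x : d <= a * x -> a^-1 * d <= x.
  by move=> dx; rewrite mulrC ler_pdivrMr// mulrC.
have dh f' x : derivable (diffeo_inv f') x 1 by case: (diffeoP (diffeo_inv f')).
have dd : d ^+ 2 <= d by nra.
apply: norm11_le => //.
- by move=> y; apply: le_trans (hk y) _; exact: ad.
- move=> y; rewrite derive1B_fun//.
  apply: le_trans (inv_derive_dist_le y a0 fa ga) _.
  have H1 := fd1 _ _ (le_trans (hk y) (ad _ d_ad1)).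
  have H2 := Hds (diffeo_inv g y).
  apply: (@le_trans _ _ (a^-1 ^+ 2 * (om + om))).
    apply: ler_wpM2l; first by rewrite exprn_ge0// invr_ge0 ltW.
    by apply: lerD => //; exact: le_trans H2 _.
  rewrite le_eqVlt; apply/orP; left; apply/eqP; rewrite /om.
  by field; rewrite gt_eqF.
- apply: (le_trans (integral_inv_sub_le a0 fa gb)).
  apply: (@le_trans _ _ ((a^-1 ^+ 2 * b)%:E * (d ^+ 2)%:E)%E).
    by apply: lee_wpmul2l Hi; rewrite lee_fin mulr_ge0 ?sqr_ge0// ltW.
  rewrite -EFinM lee_fin -mulrA exprVn mulrC ler_pdivrMr ?exprn_gt0//.
  apply: (@le_trans _ _ (b * d)); first by rewrite ler_wpM2l// ltW.
  by rewrite mulrC -ler_pdivlMr// [e ^+ 2 * _]mulrC.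
- rewrite (derive1B_fun (dh f) (dh g)).
  apply: (le_trans (integral_inv_derive_sub_le a0 fa ga gb)).
  apply: (@le_trans _ _ ((2 * a^-1 ^+ 4)%:E * (E%:E + b%:E * (d ^+ 2)%:E))%E).
    apply: lee_wpmul2l.
      by rewrite lee_fin mulr_ge0// exprn_ge0// invr_ge0 ltW.
    apply: leeD.
      have := fd2 _ gb (fun y => le_trans (hk y) (ad _ d_ad2)).
      apply: le_trans; rewrite le_eqVlt; apply/orP; left; apply/eqP.
      by apply: eq_integral => y _; congr EFin; rewrite /w; ring.
    by apply: lee_wpmul2l Hdi; rewrite lee_fin ltW.
  rewrite -(EFinM b) -(EFinD E) -EFinM lee_fin.
  have bd : b * d ^+ 2 <= E.
    apply: (@le_trans _ _ (b * d)); first by rewrite ler_wpM2l// ltW.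
    by rewrite mulrC -ler_pdivlMr.
  apply: (@le_trans _ _ (2 * a^-1 ^+ 4 * (E + E))).
    apply: ler_wpM2l; first by rewrite mulr_ge0// exprn_ge0// invr_ge0 ltW.
    by rewrite lerD2l.
  rewrite le_eqVlt; apply/orP; left; apply/eqP; rewrite /E.
  by field; rewrite gt_eqF.
Unshelve. all: by end_near. Qed.

End diffeo_inverse.

Theorem lemma5 (R : realType) : continuous (@diffeo_inv R).
Proof.
move=> f.
apply/(@metricType_numDomainType.cvgrPdist_lt _ _ _ _ (nbhs_filter f)) => e e0.
have [|d d0 fd] := @diffeo_inv_dist_small R f (e / 8); first by rewrite divr_gt0.
apply/metricType_numDomainType.nbhs_mdistP; exists d => //= g fg.
have /fd := ltW fg; rewrite diffeo_mdistE -/(diffeo_dist _ _) => H.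
by apply: (le_lt_trans H); lra.
Qed.
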